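(* Let $S$ be a factorizable inverse monoid (with zero) with semilattice of idempotents $E$ and group of units $G$ such that the natural connection $\theta$ is a dual isomorphism from $E$ to a sublattice of $L(G)$. Then any two composition subcentral idempotent series of $S$ are isomorphic, and any two composition central idempotent series of $S$ are isomorphic.
   Context: All inverse monoids have a zero $0$ and identity $1$. For an inverse monoid $S$, $E$ is its semilattice of idempotents, $G$ its group of units, and $\leq$ is the natural partial order ($a\leq b$ iff $a=eb$ for some $e\in E$). $S$ is factorizable if $S=EG$ (equivalently $S=GE$). $L(G)$ is the lattice of subgroups of $G$. The natural connection is $\theta:E\to L(G)$, $e\theta=\{g\in G: eg=e\}$. That $\theta$ is a dual isomorphism from $E$ to a sublattice of $L(G)$ means: $\theta$ is injective, its image is a sublattice of $L(G)$, and $e\leq f\iff f\theta\subseteq e\theta$. For an idempotent $e$, $e^{\upharpoonright}=\{s\in S: e\leq s\}$, an inverse submonoid of $S$. An element $c$ of an inverse semigroup $T$ is central in $T$ if $ct=tc$ for all $t\in T$. For idempotents $e,f$ with $f$ central in $e^{\upharpoonright}$ (in particular $f\in e^{\upharpoonright}$), $F_{e,f}=fe^{\upharpoonright}=\{fs: s\in e^{\upharpoonright}\}$, an inverse subsemigroup of $e^{\upharpoonright}$ with identity $f$. A subcentral (resp. central) idempotent series of $S$ of length $n$ is a chain of idempotents $0=e_0\leq e_1\leq\cdots\leq e_n=1$ such that $e_{i+1}$ is central in $e_i^{\upharpoonright}$ (resp. in $S$) for every $0\leq i\leq n-1$. Its factors are $F_{e_i,e_{i+1}}$, $0\leq i\leq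 n-1$. Two subcentral (resp. central) idempotent series are isomorphic if they have the same length and there is a one-to-one correspondence between their factors such that corresponding factors are isomorphic (as semigroups). One subcentral (resp. central) series is a subcentral (resp. central) refinement of another if all terms of the second occur as terms of the first. A subcentral (resp. central) idempotent series is a composition subcentral (resp. central) idempotent series if it has no repeated terms and cannot be refined (by a subcentral, resp. central, series) except by repeating terms. *)

(* Defs.v *)
From mathcomp Require Import all_boot.
From mathcomp Require Import classical_sets functions.

Set Implicit Arguments.
Unset Strict Implicit.
Unset Printing Implicit Defensive.

Local Open Scope classical_set_scope.
Local Open Scope group_scope.

Definition inverse_monoid (S : monoidType) : Prop :=
  forall s : S, exists! t : S, s * t * s = s /\ t * s * t = t.

Definition is_zero (S : monoidType) (z : S) : Prop :=
  forall s : S, z * s = z /\ s * z = z.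

Definition idempotents (S : monoidType) : set S := [set e | e * e = e].
Arguments idempotents : clear implicits.

Definition units (S : monoidType) : set S :=
  [set g | exists h : S, g * h = 1 /\ h * g = 1].
Arguments units : clear implicits.

Definition natural_le (S : monoidType) (a b : S) : Prop :=
  exists2 e : S, idempotents S e & a = e * b.

Definition factorizable (S : monoidType) : Prop :=
  forall s : S, exists e g : S, [/\ idempotents S e, units S g & s = e * g].

(* L(G), where G is the group of units; the join of H and K in this lattice
   is [smallest (unit_subgroups S) (H `|` K)]. *)
Definition unit_subgroups (S : monoidType) : set (set S) :=
  [set H | [/\ H `<=` units S,
               H 1,
               forall x y, H x -> H y -> H (x * y) &
               forall x y, H x -> x * y = 1 -> y * x = 1 -> H y]].
Arguments unit_subgroups : clear implicits.

Definition sublattice_of_subgroups (S : monoidType) (L : set (set S)) : Prop :=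
  L `<=` unit_subgroups S /\
  forall H K, L H -> L K ->
    L (H `&` K) /\ L (smallest (unit_subgroups S) (H `|` K)).

Definition natural_connection (S : monoidType) (e : S) : set S :=
  [set g | units S g /\ e * g = e].

Definition natural_connection_dual_iso (S : monoidType) : Prop :=
  [/\ set_inj (idempotents S) (@natural_connection S),
      sublattice_of_subgroups (@natural_connection S @` idempotents S) &
      forall e f : S, idempotents S e -> idempotents S f ->
        (natural_le e f <-> natural_connection f `<=` natural_connection e)].

Definition up_set (S : monoidType) (e : S) : set S :=
  [set s | natural_le e s].

Definition central_in (S : monoidType) (T : set S) (c : S) : Prop :=
  T c /\ forall t, T t -> commute c t.

Definition factor (S : monoidType) (e f : S) : set S :=
  (fun s => f * s) @` up_set e.

(* Isomorphism of two subsemigroups of S; the values of phi outside A are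
   irrelevant. *)
Definition semigroup_iso (S : monoidType) (A B : set S) : Prop :=
  exists phi : S -> S, set_bij A B phi /\
    forall x y, A x -> A y -> phi (x * y) = phi x * phi y.

(* For i : 'I_n, [src e i] and [tgt e i] are e_i and e_(i+1). *)
Definition src (S : Type) (n : nat) (e : 'I_n.+1 -> S) (i : 'I_n) : S :=
  e (widen_ord (leqnSn n) i).
Definition tgt (S : Type) (n : nat) (e : 'I_n.+1 -> S) (i : 'I_n) : S :=
  e (lift ord0 i).

(* Chains of idempotents from z to 1 with [C e_i e_(i+1)] for all i; C is
   instantiated below by the two centrality conditions. *)
Definition idempotent_series (S : monoidType) (C : S -> S -> Prop) (z : S)
    (n : nat) (e : 'I_n.+1 -> S) : Prop :=
  [/\ e ord0 = z,
      e ord_max = 1,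
      forall i, idempotents S (e i),
      forall i, natural_le (src e i) (tgt e i) &
      forall i, C (src e i) (tgt e i)].

(* A refinement may always repeat terms, so maximality is up to the set of
   terms. *)
Definition composition_series (S : monoidType) (C : S -> S -> Prop) (z : S)
    (n : nat) (e : 'I_n.+1 -> S) : Prop :=
  [/\ idempotent_series C z e,
      injective e &
      forall (m : nat) (f : 'I_m.+1 -> S),
        idempotent_series C z f -> range e `<=` range f ->
        range f `<=` range e].

Definition composition_subcentral_series (S : monoidType) (z : S) (n : nat)
    (e : 'I_n.+1 -> S) : Prop :=
  composition_series (fun a b => central_in (up_set a) b) z e.

Definition composition_central_series (S : monoidType) (z : S) (n : nat)
    (e : 'I_n.+1 -> S) : Prop :=
  composition_series (fun _ b => central_in [set: S] b) z e.

Definition isomorphic_series (S : monoidType) (n m : nat)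
    (e : 'I_n.+1 -> S) (f : 'I_m.+1 -> S) : Prop :=
  n = m /\
  exists sigma : 'I_n -> 'I_m, bijective sigma /\
    forall i, semigroup_iso (factor (src e i) (tgt e i))
                            (factor (src f (sigma i)) (tgt f (sigma i))).

(* Main.v *)
(* The natural connection theta turns S into group theory: e is central in
   the up-set of a lower idempotent a exactly when theta e is normal in
   theta a, meets of idempotents become joins of subgroups, and joins become
   intersections, so subcentral series correspond to subnormal series of G.
   Multiplication by b realizes the second isomorphism theorem on factors
   (the diamond), and two diamonds give Zassenhaus' butterfly.  Interpolating
   one composition series between consecutive terms of the other, the
   interpolation has exactly one nontrivial step; by the butterfly a step is
   nontrivial on one side iff it is on the other, so the positions of the
   nontrivial steps define the bijection between the factors. *)

Require Import Defs.
From mathcomp Require Import all_boot.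
From mathcomp Require Import classical_sets functions boolp.

Set Implicit Arguments.
Unset Strict Implicit.
Unset Printing Implicit Defensive.

Local Open Scope classical_set_scope.
Local Open Scope group_scope.

(** * Composition and inversion of semigroup isomorphisms *)

Section SemigroupIso.
Variable S : monoidType.
Implicit Types A B C : set S.

Lemma semigroup_iso_trans A B C :
  semigroup_iso A B -> semigroup_iso B C -> semigroup_iso A C.
Proof.
move=> [phi [[phiAB phi_inj phi_surj] phiM]] [psi [[psiBC psi_inj psi_surj] psiM]].
exists (psi \o phi); split; last first.
  by move=> x y Ax Ay /=; rewrite phiM // psiM //; apply: phiAB.
split.
- by move=> x Ax; apply/psiBC/phiAB.
- move=> x y; rewrite !in_setE => Ax Ay /= eq_xy.
  by apply: phi_inj; rewrite ?in_setE //; apply: psi_inj;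
    rewrite ?in_setE //; apply: phiAB.
- by move=> c /psi_surj [b /phi_surj [a Aa <-] <-]; exists a.
Qed.

(** Closure of [A] keeps [psi x * psi y] in the set where [phi] is injective; this makes the inverse
    map [psi] multiplicative. *)
Lemma semigroup_iso_sym A B :
  (forall x y, A x -> A y -> A (x * y)) ->
  semigroup_iso A B -> semigroup_iso B A.
Proof.
move=> AM [phi [[phiAB phi_inj phi_surj] phiM]].
have /choice [psi psiP] : forall y, exists x, B y -> A x /\ phi x = y.
  move=> y; have [By|nBy] := pselect (B y); last by exists y.
  by have [x Ax <-] := phi_surj _ By; exists x.
have phi_eq x y : A x -> A y -> phi x = phi y -> x = y.
  by move=> Ax Ay; apply: phi_inj; rewrite in_setE.
exists psi; split; last first.
  move=> x y Bx By; have [Ax xE] := psiP _ Bx; have [Ay yE] := psiP _ By.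
  have AMxy := AM _ _ Ax Ay.
  have Bxy : B (x * y) by rewrite -xE -yE -phiM //; apply: phiAB.
  have [Axy xyE] := psiP _ Bxy.
  by apply: phi_eq => //; rewrite xyE phiM // xE yE.
split.
- by move=> y /psiP [].
- move=> x y; rewrite !in_setE => /psiP [_ xE] /psiP [_ yE] eq_xy.
  by rewrite -xE -yE eq_xy.
- move=> x Ax; have [Apx pxE] := psiP _ (phiAB _ Ax).
  by exists (phi x); [apply: phiAB | apply: phi_eq].
Qed.

End SemigroupIso.

(** * The group of units and the subgroups [natural_connection e] *)

Section Units.
Variable S : monoidType.
Implicit Types g h : S.

Definition unit_inv g : S := xget 1 [set h | g * h = 1 /\ h * g = 1].

Lemma unit_invP g : units S g -> g * unit_inv g = 1 /\ unit_inv g * g = 1.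
Proof.
move=> [h gh]; rewrite /unit_inv.
by case: xgetP => [k _ //|/(_ h)]; case.
Qed.

Lemma mul_unit_inv g : units S g -> g * unit_inv g = 1.
Proof. by case/unit_invP. Qed.

Lemma mul_inv_unit g : units S g -> unit_inv g * g = 1.
Proof. by case/unit_invP. Qed.

Lemma units_inv g : units S g -> units S (unit_inv g).
Proof. by move=> /unit_invP [gV Vg]; exists g. Qed.

Lemma unitsM g h : units S g -> units S h -> units S (g * h).
Proof.
move=> [g' [gg' g'g]] [h' [hh' h'h]]; exists (h' * g'); split.
  by rewrite mulgA -(mulgA g) hh' mulg1.
by rewrite mulgA -(mulgA h') g'g mulg1.
Qed.

Lemma natural_connectionM (e g h : S) :
  natural_connection e g -> natural_connection e h -> natural_connection e (g * h).
Proof. by move=> [ug eg] [uh eh]; split; [exact: unitsM | rewrite mulgA eg]. Qed.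

Lemma natural_connectionV (e g : S) :
  natural_connection e g -> natural_connection e (unit_inv g).
Proof.
move=> [ug eg]; split; first exact: units_inv.
by rewrite -{1}eg -mulgA mul_unit_inv // mulg1.
Qed.

End Units.

(** * Idempotents, the natural order and up-sets in an inverse monoid *)

Section InverseMonoid.
Variable S : monoidType.
Hypothesis S_inverse : inverse_monoid S.
Implicit Types (e f s : S).

Lemma inverse_unique s t u : s * t * s = s -> t * s * t = t ->
  s * u * s = s -> u * s * u = u -> t = u.
Proof.
move=> sts tst sus usu; have [v [_ vP]] := S_inverse s.
by rewrite -(vP t) // -(vP u).
Qed.

(** If [x] is the inverse of [e * f], then so is [f * x * e], hence the two agree and [x] is
    idempotent. An idempotent is its own inverse, and [e * f] is also an inverse of [x], so
    [e * f = x]. *)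
Lemma idempotentM e f : e * e = e -> f * f = f -> e * f * (e * f) = e * f.
Proof.
move=> ee ff; have [x [[efx xef] _]] := S_inverse (e * f).
have eqx : f * x * e = x.
  apply: (@inverse_unique (e * f)) => //; rewrite ?efx // !mulgA.
    by rewrite -(mulgA e f f) ff -(mulgA _ e e) ee -[RHS]efx !mulgA.
  rewrite -(mulgA _ e e) ee -(mulgA _ f f) ff.
  by rewrite -[in RHS]xef !mulgA.
have xx : x * x = x by rewrite -eqx -[in RHS]xef !mulgA.
suff -> : e * f = x by [].
by apply: (@inverse_unique x); rewrite ?xx.
Qed.

(** Both [e * f] and [f * e] are inverses of [e * f]. *)
Lemma idempotentC e f : e * e = e -> f * f = f -> e * f = f * e.
Proof.
move=> ee ff; have efef := idempotentM ee ff; have fefe := idempotentM ff ee.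
apply: (@inverse_unique (e * f)); rewrite ?efef // !mulgA.
  by rewrite -(mulgA e f f) ff -(mulgA _ e e) ee -[RHS]efef !mulgA.
by rewrite -(mulgA f e e) ee -(mulgA _ f f) ff -[RHS]fefe !mulgA.
Qed.

Lemma natural_leE e s : e * e = e -> natural_le e s <-> e * s = e.
Proof.
move=> ee; split=> [[f ff eE]|es]; last by exists e.
have fe : f * e = e by rewrite eE mulgA ff.
by rewrite -{1}fe (idempotentC ff ee) -mulgA -eE.
Qed.

Lemma natural_le_trans e f s : e * f = e -> f * s = f -> e * s = e.
Proof. by move=> <- fs; rewrite -mulgA fs. Qed.

(** Each of [e] and [f] is the other times a unit, so each absorbs the other from the left; as
    idempotents commute, they are equal. *)
Lemma idempotent_mul_unit e f (g : S) : e * e = e -> f * f = f -> units S g ->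
  e * g = f -> e = f.
Proof.
move=> ee ff ug eg; have fg : f * unit_inv g = e.
  by rewrite -eg -mulgA mul_unit_inv // mulg1.
rewrite -[LHS]fg -{1}ff -mulgA fg (idempotentC ff ee) -eg mulgA ee //.
Qed.

Lemma conj_idempotent e (g : S) : e * e = e -> units S g ->
  unit_inv g * e * g * (unit_inv g * e * g) = unit_inv g * e * g.
Proof.
by move=> ee ug; rewrite !mulgA -(mulgA _ g) mul_unit_inv // mulg1 -(mulgA _ e e) ee.
Qed.

(** Since [e * g = e], the element [unit_inv g * e] is a conjugate of [e], hence an idempotent.
    Commuting it with [e] shows that [unit_inv g] fixes [e] from the left too. *)
Lemma natural_connection_left e (g : S) : e * e = e ->
  natural_connection e g -> g * e = e.
Proof.
move=> ee eg; have [ug eg1] := eg; have [_ egV] := natural_connectionV eg.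
have Ve : unit_inv g * e = unit_inv g * e * g by rewrite -mulgA eg1.
have Vee : unit_inv g * e = e.
  have := idempotentC ee (conj_idempotent ee ug).
  by rewrite -Ve mulgA egV ee -mulgA ee.
by rewrite -{1}Vee mulgA mul_unit_inv // mul1g.
Qed.

Lemma commute_natural_connection e (g : S) : e * e = e ->
  natural_connection e g -> commute e g.
Proof. by move=> ee eg; rewrite /commute (natural_connection_left ee eg); case: eg. Qed.

Lemma central_in_up_le e f : e * e = e -> central_in (up_set e) f -> e * f = e.
Proof. by move=> ee [/(natural_leE _ ee)]. Qed.

Lemma central_in_up_commute e f (g : S) : e * e = e -> central_in (up_set e) f ->
  natural_connection e g -> commute f g.
Proof. by move=> ee [_ fC] [_ eg]; apply: fC; apply/natural_leE. Qed.

Lemma central_in_up_sub e f x : e * e = e -> x * x = x -> e * x = e -> x * f = x ->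
  central_in (up_set e) f -> central_in (up_set x) f.
Proof.
move=> ee xx ex xf [_ fC]; split; first by apply/natural_leE.
move=> t /(natural_leE _ xx) xt; apply: fC; apply/natural_leE => //.
exact: natural_le_trans xt.
Qed.

Lemma central_in_setT_up e f : e * e = e -> e * f = e ->
  central_in [set: S] f -> central_in (up_set e) f.
Proof. by move=> ee ef [_ fC]; split; [apply/natural_leE | move=> t _; apply: fC]. Qed.

Lemma factor_closed e f : e * e = e -> central_in (up_set e) f -> f * f = f ->
  forall s t, factor e f s -> factor e f t -> factor e f (s * t).
Proof.
move=> ee [ef fC] ff _ _ [s es <-] [t et <-].
have [es1 ef1] : e * s = e /\ e * f = e by split; apply/natural_leE.
have et1 : e * t = e by apply/natural_leE.
exists (s * (f * t)); first by apply/natural_leE => //; rewrite !mulgA es1 ef1.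
by rewrite !mulgA.
Qed.

End InverseMonoid.

(** * Translation of centrality, joins and meets into subgroups of units *)

Section DualIsomorphism.
Variable S : monoidType.
Hypothesis S_inverse : inverse_monoid S.
Hypothesis S_factorizable : factorizable S.
Hypothesis theta_dual_iso : natural_connection_dual_iso S.
Implicit Types (a b c d e f g h x y s t : S).

Local Notation theta := (@natural_connection S).

(** Factorize [s] as [x * g]; then [e * x] and [e] differ by the unit [g], hence coincide, and this
    puts [g] in [theta e]. *)
Lemma up_set_decomposition e s : e * e = e -> e * s = e ->
  exists x g, [/\ x * x = x, theta e g, e * x = e & s = x * g].
Proof.
move=> ee; have [x [g [xx ug ->]]] := S_factorizable s.
rewrite mulgA => exg; have ex : e * x = e.
  by apply: (idempotent_mul_unit S_inverse _ ee ug exg); apply: idempotentM.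
by exists x, g; split=> //; split=> //; rewrite -[RHS]exg ex.
Qed.

(** Elements above [e] are products of an idempotent, which commutes with [f] anyway, and a unit of
    [theta e]. *)
Lemma central_in_upP e f : e * e = e -> f * f = f ->
  central_in (up_set e) f <->
  e * f = e /\ forall g, theta e g -> commute f g.
Proof.
move=> ee ff; split=> [fC|[ef fC]].
  split; first exact: central_in_up_le fC.
  by move=> g; apply: central_in_up_commute.
split; first by apply/natural_leE.
move=> t /(natural_leE S_inverse _ ee) /(up_set_decomposition ee) [x [g [xx eg _ ->]]].
by apply: commuteM; [apply: idempotentC | apply: fC].
Qed.

Lemma central_in_setTP f : f * f = f ->
  central_in [set: S] f <-> forall g, units S g -> commute f g.
Proof.
move=> ff; split=> [[_ fC] g _|fC]; first exact: fC.
split=> // t _; have [x [g [xx ug ->]]] := S_factorizable t.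
by apply: commuteM; [apply: idempotentC | apply: fC].
Qed.

Lemma theta_le e f : e * e = e -> f * f = f -> e * f = e <-> theta f `<=` theta e.
Proof.
move=> ee ff; have [_ _ /(_ e f ee ff) <-] := theta_dual_iso.
by rewrite (natural_leE S_inverse f ee).
Qed.

Lemma theta_inj e f : e * e = e -> f * f = f -> theta e = theta f -> e = f.
Proof.
move=> ee ff ef; have [tinj _ _] := theta_dual_iso.
by apply: tinj; rewrite ?in_setE.
Qed.

(** The least upper bound in [E], since [theta] reverses the order. For idempotents it exists
    because the image of [theta] is closed under intersection, so the default [1] does not arise. *)
Definition join a b : S := xget 1 [set c | c * c = c /\ theta c = theta a `&` theta b].

Lemma joinP a b : a * a = a -> b * b = b ->
  join a b * join a b = join a b /\ theta (join a b) = theta a `&` theta b.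
Proof.
move=> aa bb; have [_ [_ lat] _] := theta_dual_iso.
have [[c cc cE] _] : _ := lat _ _ (ex_intro2 _ _ a aa erefl) (ex_intro2 _ _ b bb erefl).
by rewrite /join; case: xgetP => [k _ //|/(_ c) []].
Qed.

Lemma join_idempotent a b : a * a = a -> b * b = b -> join a b * join a b = join a b.
Proof. by move=> aa bb; case: (joinP aa bb). Qed.

Lemma theta_join a b : a * a = a -> b * b = b -> theta (join a b) = theta a `&` theta b.
Proof. by move=> aa bb; case: (joinP aa bb). Qed.

Lemma joinC a b : join a b = join b a.
Proof. by rewrite /join setIC. Qed.

Lemma join_ub a b : a * a = a -> b * b = b -> a * join a b = a.
Proof.
move=> aa bb; apply/theta_le => //; first exact: join_idempotent.
by rewrite theta_join //; apply: subIsetl.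
Qed.

Lemma join_absorb a b : a * a = a -> b * b = b -> a * b = a -> join a b = b.
Proof.
move=> aa bb /(theta_le aa bb) ab; apply: theta_inj => //.
  exact: join_idempotent.
by rewrite theta_join // setIC; apply/setIidPl.
Qed.

Lemma join_monotone a b c : a * a = a -> b * b = b -> c * c = c -> b * c = b ->
  join a b * join a c = join a b.
Proof.
move=> aa bb cc /(theta_le bb cc) bc; apply/theta_le; rewrite ?theta_join //;
  try exact: join_idempotent.
exact: setIS.
Qed.

Lemma theta_conj e g h : e * e = e -> units S g ->
  theta (unit_inv g * e * g) h <-> theta e (g * h * unit_inv g).
Proof.
move=> ee ug; have uV := units_inv ug.
split=> -[u eqh]; split.
- by apply: unitsM uV; apply: unitsM.
- have := congr1 (mul g) eqh; rewrite !mulgA mul_unit_inv // mul1g => ->.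
  by rewrite -mulgA mul_unit_inv // mulg1.
- have -> : h = unit_inv g * (g * h * unit_inv g) * g.
    by rewrite !mulgA mul_inv_unit // mul1g -mulgA mul_inv_unit // mulg1.
  by apply: unitsM ug; apply: unitsM.
- have := congr1 (mul^~ g) eqh; rewrite !mulgA -(mulgA _ _ g) mul_inv_unit // mulg1.
  by rewrite -!(mulgA (unit_inv g)) => ->.
Qed.

(** Commuting with [g] means that conjugation by [g] preserves the subgroup; this passes to
    intersections, and [theta] is injective. *)
Lemma join_commute a b g : a * a = a -> b * b = b -> units S g ->
  commute a g -> commute b g -> commute (join a b) g.
Proof.
move=> aa bb ug; have jj := join_idempotent aa bb.
have conjE e h : e * e = e -> commute e g -> theta e (g * h * unit_inv g) <-> theta e h.
  by move=> ee eg; rewrite -theta_conj // -mulgA eg mulgA mul_inv_unit // mul1g.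
move=> ag bg; suff jE : unit_inv g * join a b * g = join a b.
  by rewrite /commute -{2}jE !mulgA mul_unit_inv // mul1g.
apply: theta_inj => //; first exact: conj_idempotent.
apply/seteqP; split=> h.
  move/(theta_conj _ jj ug); rewrite theta_join //.
  by move=> -[/(conjE _ _ aa ag) ? /(conjE _ _ bb bg)].
move=> jh; apply/(theta_conj _ jj ug); move: jh; rewrite theta_join // => -[ah bh].
by split; apply/conjE.
Qed.

(* [theta] sends meets to joins of subgroups, and the join of two subgroups
   is their product as soon as one of them normalizes the other. *)
Lemma theta_mul a b g : a * a = a -> b * b = b ->
  (forall h, theta a h -> commute b h) -> theta (a * b) g ->
  exists k h, [/\ theta b k, theta a h & g = k * h].
Proof.
move=> aa bb aNb; have ab_id := idempotentM S_inverse aa bb.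
pose H : set S := [set g | exists k h, [/\ theta b k, theta a h & g = k * h]].
have [_ [sub lat] _] := theta_dual_iso.
have subgroup e : e * e = e -> unit_subgroups S (theta e).
  by move=> ee; apply: sub; exists e.
have one e : e * e = e -> theta e 1 by case/subgroup.
(* The idempotent [c] represents the join of [theta a] and [theta b]. It lies below [a * b], so
   [theta (a * b)] is contained in that join, and it remains to show that [H] is a subgroup
   containing both. *)
have [_ [c cc cE]] : _ := lat _ _ (ex_intro2 _ _ a aa erefl) (ex_intro2 _ _ b bb erefl).
have ca : c * a = c.
  by apply/theta_le => //; rewrite cE; apply: sub_smallest; left.
have cb : c * b = c.
  by apply/theta_le => //; rewrite cE; apply: sub_smallest; right.
suff: theta (a * b) `<=` H by exact.
apply: (@subset_trans _ (theta c)).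
  by apply/theta_le => //; rewrite mulgA ca.
(* [theta a] normalizes [theta b], which allows rewriting [h * k] as an element of [theta b] times
   [h]. *)
have swap k h : theta b k -> theta a h -> theta b (h * k * unit_inv h).
  move=> [uk bk] ah; have [uh _] := ah; split.
    by apply: unitsM (units_inv uh); apply: unitsM.
  by rewrite !mulgA (aNb h ah) -(mulgA h) bk -(aNb h ah) -mulgA mul_unit_inv ?mulg1.
rewrite cE; apply: smallest_sub; last first.
  move=> h [ah|bh]; last by exists h, 1; split=> //; [exact: one | rewrite mulg1].
  by exists 1, h; split=> //; [exact: one | rewrite mul1g].
split.
- by move=> _ [k [h [[uk _] [uh _] ->]]]; apply: unitsM.
- by exists 1, 1; split; rewrite ?mulg1 //; apply: one.
- move=> _ _ [k [h [bk ah ->]]] [k' [h' [bk' ah' ->]]].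
  have [uh _] := ah; exists (k * (h * k' * unit_inv h)), (h * h'); split.
  + exact: natural_connectionM (swap _ _ bk' ah).
  + exact: natural_connectionM.
  + by rewrite -!mulgA (mulgA (unit_inv h)) mul_inv_unit // mul1g.
- move=> _ y [k [h [bk ah ->]]] khy _.
  have [[uh _] [uk _]] := (ah, bk).
  have ahV := natural_connectionV ah.
  have yE : y = unit_inv h * unit_inv k.
    rewrite -[RHS]mulg1 -khy -!mulgA (mulgA (unit_inv k)) mul_inv_unit // mul1g.
    by rewrite mulgA mul_inv_unit // mul1g.
  exists (unit_inv h * unit_inv k * unit_inv (unit_inv h)), (unit_inv h); split => //.
    by apply: swap => //; apply: natural_connectionV.
  by rewrite -mulgA mul_inv_unit ?mulg1 //; apply: units_inv.
Qed.

(** * The diamond: the second isomorphism theorem for factors *)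

Section Diamond.
Variables a b : S.
Hypotheses (aa : a * a = a) (bb : b * b = b).
Hypothesis bC : central_in (up_set (a * b)) b.

Let ab_id : a * b * (a * b) = a * b. Proof. exact: idempotentM. Qed.
Let abC : a * b = b * a. Proof. exact: idempotentC. Qed.
Let j := join a b.
Let jj : j * j = j. Proof. exact: join_idempotent. Qed.
Let thetaj : theta j = theta a `&` theta b. Proof. exact: theta_join. Qed.
Let aj : a * j = a. Proof. exact: join_ub. Qed.
Let bj : b * j = b. Proof. by rewrite /j joinC join_ub. Qed.

Let up_aC t : a * t = a -> commute b t.
Proof.
by case: bC => _ bCt at_; apply: bCt; apply/natural_leE; rewrite // abC -mulgA at_.
Qed.

(* As [theta (b * x)] is the product of [theta b] and [theta x], this is
   Dedekind's modular law. *)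
Lemma theta_mul_cap x : x * x = x -> a * x = a -> x * j = x ->
  theta (b * x) `&` theta a = theta x.
Proof.
move=> xx ax xj; have bx_id := idempotentM S_inverse bb xx.
have xa : theta x `<=` theta a by apply/theta_le.
have jx : theta j `<=` theta x by apply/theta_le.
apply/seteqP; split=> g; last first.
  by move=> xg; split; [case: xg => ug xg; split; rewrite // -mulgA xg | apply: xa].
move=> [gbx ga].
have [k [h [bk xh gE]]] : exists k h, [/\ theta b k, theta x h & g = k * h].
  apply: theta_mul => //; last by rewrite (idempotentC S_inverse xx bb).
  by move=> h /xa [_ ah]; apply: up_aC.
rewrite gE; apply: (natural_connectionM _ xh); apply: jx; rewrite thetaj; split=> //.
have -> : k = g * unit_inv h by rewrite gE -mulgA mul_unit_inv ?mulg1 //; case: xh.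
by apply: (natural_connectionM ga); apply: natural_connectionV; apply: xa.
Qed.

Lemma diamond_iso : semigroup_iso (factor a j) (factor (a * b) b).
Proof.
have up_factor t : factor a j t -> a * t = a /\ j * t = t.
  move=> [s /(natural_leE S_inverse _ aa) as_ <-].
  by rewrite !mulgA jj aj as_.
exists (fun s => b * s); split; last first.
  move=> s t /up_factor [as_ _] _.
  by rewrite -(mulgA b s) (mulgA s b) -(up_aC as_) !mulgA bb.
split.
- move=> s /up_factor [as_ _]; exists s => //.
  by apply/natural_leE; rewrite // abC -mulgA as_.
- move=> s t; rewrite !in_setE => /up_factor [as_ js] /up_factor [at_ jt] eqst.
  have [x [h [xx ah ax sE]]] := up_set_decomposition aa as_.
  have [y [k [yy ak ay tE]]] := up_set_decomposition aa at_.
  (* Multiplying by [j] moves both idempotents between [a] and [j], where [theta_mul_cap] applies,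
     without changing [s] and [t]. *)
  pose x' := j * x; pose y' := j * y.
  have x'_id : x' * x' = x' by apply: idempotentM.
  have y'_id : y' * y' = y' by apply: idempotentM.
  have ax' : a * x' = a by rewrite mulgA aj.
  have ay' : a * y' = a by rewrite mulgA aj.
  have x'j : x' * j = x' by rewrite (idempotentC S_inverse x'_id jj) mulgA jj.
  have y'j : y' * j = y' by rewrite (idempotentC S_inverse y'_id jj) mulgA jj.
  have sE' : s = x' * h by rewrite -js sE mulgA.
  have tE' : t = y' * k by rewrite -jt tE mulgA.
  have [[uh _] [uk _]] := (ah, ak).
  (* So [b * x'] and [b * y'] differ by a unit and agree. The modular law then recovers [x' = y']
     and puts [h * unit_inv k] in [theta x'], which gives [s = t]. *)
  have eqbx : b * x' * (h * unit_inv k) = b * y'.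
    by rewrite mulgA -(mulgA b) -sE' eqst tE' -!mulgA mul_unit_inv // mulg1.
  have uhk : units S (h * unit_inv k) by apply: unitsM => //; apply: units_inv.
  have bxy : b * x' = b * y'.
    by apply: (idempotent_mul_unit S_inverse _ _ uhk eqbx); apply: idempotentM.
  have xy : x' = y'.
    by apply: theta_inj => //; rewrite -(theta_mul_cap x'_id ax' x'j) bxy theta_mul_cap.
  have [_ xhk] : theta x' (h * unit_inv k).
    rewrite -theta_mul_cap //; split; first by split; rewrite // eqbx.
    by apply: (natural_connectionM ah); apply: natural_connectionV.
  rewrite sE' tE' -xy -[in RHS]xhk -!mulgA mul_inv_unit // mulg1 //.
- move=> _ [t /(natural_leE S_inverse _ ab_id) abt <-].
  have [x [g [xx abg abx tE]]] := up_set_decomposition ab_id abt.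
  have aNb h : theta a h -> commute b h by move=> [_ ah]; apply: up_aC.
  have [k [h [bk ah gE]]] := theta_mul aa bb aNb abg.
  have [_ bk1] := bk; have [_ ah1] := ah.
  (* The target [b * t] equals [e * k * h], and [e] absorbs [k]. A preimage of [e * h] thus needs an
     idempotent above [a] that [b] multiplies to [e]: the join [w] of [e] and [a]. *)
  pose e := b * x; have ee : e * e = e by apply: idempotentM.
  have be : b * e = e by rewrite mulgA bb.
  have eb : e * b = e by rewrite (idempotentC S_inverse ee bb).
  pose w := join e a; have ww : w * w = w by apply: join_idempotent.
  have wE : theta w = theta e `&` theta a by apply: theta_join.
  have aw : a * w = a by rewrite /w joinC join_ub.
  have ew : e * w = e by apply: join_ub.
  have jw : j * w = w.
    rewrite (idempotentC S_inverse jj ww); apply/theta_le => //.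
    rewrite wE thetaj => u [au bu]; split=> //.
    by have /theta_le : e * b = e by []; apply.
  exists (j * (w * h)).
    by exists (w * h) => //; apply/natural_leE => //; rewrite mulgA aw.
  (* Dedekind's law again: [theta b] lies in [theta e], which lies in the product of [theta b] and
     [theta a]. Dividing an element of [theta e] by its [theta b] part leaves an element of
     [theta w]. *)
  have bw : b * w = e.
    have bw_id := idempotentM S_inverse bb ww.
    apply: theta_inj => //; apply/seteqP; split.
      by apply/theta_le => //; rewrite mulgA eb ew.
    move=> u eu.
    have abu : theta (a * b) u.
      by move: u eu; apply/theta_le => //; rewrite /e mulgA -(mulgA a) bb abx.
    have [k' [h' [bk' ah' uE]]] := theta_mul aa bb aNb abu.
    have wh' : theta w h'.
      rewrite wE; split=> //; have [uk' _] := bk'.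
      have -> : h' = unit_inv k' * u by rewrite uE mulgA mul_inv_unit // mul1g.
      apply: (natural_connectionM _ eu); apply: natural_connectionV.
      by move: k' bk' {uE uk'}; apply/theta_le.
    rewrite uE; apply: natural_connectionM; last first.
      by case: wh' => uh' wh'; split; rewrite // -mulgA wh'.
    case: bk' => uk' bk'; split=> //.
    by rewrite (idempotentC S_inverse bb ww) -mulgA bk'.
  have ek : e * k = e.
    by rewrite /e (idempotentC S_inverse bb xx) -mulgA bk1.
  by rewrite (mulgA j) jw mulgA bw tE gE !mulgA -/e ek.
Qed.

End Diamond.

(** * Interpolation between two idempotents and the butterfly *)

(** Supplies the closure under products that is required to invert a diamond isomorphism. *)
Lemma factor_join_closed a b : a * a = a -> b * b = b ->
  central_in (up_set (a * b)) b ->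
  forall s t, factor a (join a b) s -> factor a (join a b) t ->
  factor a (join a b) (s * t).
Proof.
move=> aa bb bC; have jj := join_idempotent aa bb.
apply: (factor_closed S_inverse) => //; apply/central_in_upP => //.
split=> [|g ag]; first exact: join_ub.
apply: join_commute => //; first by case: ag.
  exact: commute_natural_connection.
have [_ ag1] := ag; case: bC => _; apply; apply/natural_leE => //.
  exact: idempotentM.
by rewrite (idempotentC S_inverse aa bb) -mulgA ag1.
Qed.

(* In terms of subgroups, theta b (theta a /\ theta c). *)
Definition interpolate a b c := b * join a c.

Lemma interpolate_idempotent a b c : a * a = a -> b * b = b -> c * c = c ->
  interpolate a b c * interpolate a b c = interpolate a b c.
Proof. by move=> aa bb cc; apply: idempotentM => //; apply: join_idempotent. Qed.

Lemma interpolate_ge a b c : a * a = a -> b * b = b -> c * c = c -> a * b = a ->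
  a * interpolate a b c = a.
Proof. by move=> aa bb cc ab; rewrite mulgA ab join_ub. Qed.

Lemma interpolate_le a b c : a * a = a -> b * b = b -> c * c = c ->
  interpolate a b c * b = interpolate a b c.
Proof.
move=> aa bb cc; have jj := join_idempotent aa cc.
by rewrite /interpolate (idempotentC S_inverse bb jj) -mulgA bb.
Qed.

Lemma interpolate_monotone a b c d : a * a = a -> b * b = b -> c * c = c ->
  d * d = d -> c * d = c ->
  interpolate a b c * interpolate a b d = interpolate a b c.
Proof.
move=> aa bb cc dd cd; have jj := join_idempotent aa cc.
by rewrite mulgA interpolate_le // -mulgA join_monotone.
Qed.

(** With [c] the zero here and [c = 1] in [interpolate_top], the interpolation of a whole series
    runs from [a] to [b]. *)
Lemma interpolate_bot a b c : a * a = a -> b * b = b -> c * c = c ->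
  a * b = a -> c * a = c -> interpolate a b c = a.
Proof.
move=> aa bb cc ab ca.
by rewrite /interpolate joinC join_absorb // (idempotentC S_inverse bb aa).
Qed.

Lemma interpolate_top a b c : a * a = a -> b * b = b -> c * c = c ->
  a * b = a -> b * c = b -> interpolate a b c = b.
Proof.
move=> aa bb cc ab bc; rewrite /interpolate join_absorb //.
by rewrite -ab -mulgA bc.
Qed.

(** Normality in Zassenhaus' lemma. An element of the larger subgroup is [k * h] with [k] in
    [theta b] and [h] in both [theta a] and [theta c]. The upper idempotent absorbs [k], while [h]
    commutes with [b], [a] and [d]. *)
Lemma interpolate_central_up a b c d : a * a = a -> b * b = b -> c * c = c ->
  d * d = d -> central_in (up_set a) b -> central_in (up_set c) d ->
  central_in (up_set (interpolate a b c)) (interpolate a b d).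
Proof.
move=> aa bb cc dd /(central_in_upP aa bb) [ab bC] /(central_in_upP cc dd) [cd dC].
have u_id := interpolate_idempotent aa bb cc.
have v_id := interpolate_idempotent aa bb dd.
have [p_id q_id] := (join_idempotent aa cc, join_idempotent aa dd).
apply/central_in_upP => //; split=> [|g ug]; first exact: interpolate_monotone.
have pNb h : theta (join a c) h -> commute b h.
  by rewrite theta_join // => -[ah _]; apply: bC.
have pu : theta (join a c * b) g by rewrite (idempotentC S_inverse p_id bb).
have [k [h [bk ph ->]]] := theta_mul p_id bb pNb pu.
apply: commuteM.
  apply: commute_natural_connection => //; case: bk => uk bk; split=> //.
  by rewrite /interpolate (idempotentC S_inverse bb q_id) -mulgA bk.
apply: commute_sym; apply: commuteM; apply: commute_sym; first exact: pNb.
move: ph; rewrite theta_join // => -[ah ch]; apply: join_commute => //.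
- by case: ah.
- exact: commute_natural_connection.
- exact: dC.
Qed.

Lemma interpolate_central a b d : a * a = a -> b * b = b -> d * d = d ->
  central_in [set: S] a -> central_in [set: S] b -> central_in [set: S] d ->
  central_in [set: S] (interpolate a b d).
Proof.
move=> aa bb dd aC bC dC; apply/central_in_setTP.
  exact: interpolate_idempotent.
move=> g ug; apply: commute_sym; apply: commuteM; apply: commute_sym.
  by case: bC => _; apply.
by apply: join_commute => //; [case: aC | case: dC] => _; apply.
Qed.

(** Write [g = k * h] with [k] in [theta b] and [h] in both [theta a] and [theta d]. As [g] and [h]
    lie in [theta c], so does [k]. Applied in both directions, this identifies the tops of the two
    diamonds of the butterfly. *)
Lemma theta_cap_interpolate a b c d : a * a = a -> b * b = b -> c * c = c ->
  d * d = d -> central_in (up_set a) b -> c * d = c ->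
  theta (join a c) `&` theta (interpolate a b d) `<=` theta (interpolate c d b).
Proof.
move=> aa bb cc dd /(central_in_upP aa bb) [ab bC] /(theta_le cc dd) cd g.
rewrite theta_join // => -[[ag cg] vg].
have [q_id r_id] := (join_idempotent aa dd, join_idempotent cc bb).
have qNb h : theta (join a d) h -> commute b h.
  by rewrite theta_join // => -[ah _]; apply: bC.
have gq : theta (join a d * b) g by rewrite (idempotentC S_inverse q_id bb).
have [k [h [bk qh gE]]] := theta_mul q_id bb qNb gq.
move: qh; rewrite theta_join // => -[ah dh]; have [uh dh1] := dh.
have [_ rk] : theta (join c b) k.
  rewrite theta_join //; split=> //.
  have -> : k = g * unit_inv h by rewrite gE -mulgA mul_unit_inv // mulg1.
  by apply: (natural_connectionM cg); apply: natural_connectionV; apply: cd.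
split; first by case: ag.
by rewrite /interpolate gE mulgA -(mulgA d) rk (idempotentC S_inverse dd r_id) -mulgA dh1.
Qed.

(* Zassenhaus' butterfly: both factors are isomorphic, by the diamond, to one
   and the same factor with bottom [join a c]. *)
Lemma zassenhaus_iso a b c d : a * a = a -> b * b = b -> c * c = c ->
  d * d = d -> central_in (up_set a) b -> central_in (up_set c) d ->
  semigroup_iso (factor (interpolate a b c) (interpolate a b d))
                (factor (interpolate c d a) (interpolate c d b)).
Proof.
move=> aa bb cc dd bC dC.
have [ab cd] := (central_in_up_le S_inverse aa bC, central_in_up_le S_inverse cc dC).
(* This computes the bottoms of the two diamonds: [join a c] meets the upper term of each wing in
   its lower term. *)
have meet x y z t : x * x = x -> y * y = y -> z * z = z -> t * t = t -> z * t = z ->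
    join x z * interpolate x y t = interpolate x y z.
  move=> xx yy zz tt zt; have p_id := join_idempotent xx zz.
  rewrite mulgA (idempotentC S_inverse p_id yy) -mulgA join_monotone //.
have [p_id v_id] := (join_idempotent aa cc, interpolate_idempotent aa bb dd).
have w_id := interpolate_idempotent cc dd bb.
have vC : central_in (up_set (join a c * interpolate a b d)) (interpolate a b d).
  by rewrite meet //; apply: interpolate_central_up.
have wC : central_in (up_set (join a c * interpolate c d b)) (interpolate c d b).
  by rewrite joinC meet //; apply: interpolate_central_up.
(* Both diamonds therefore share the factor from [join a c] to this common join. *)
have joinE : join (join a c) (interpolate a b d) = join (join a c) (interpolate c d b).
  apply: theta_inj; try exact: join_idempotent.
  rewrite !(theta_join p_id) //; apply/seteqP; split=> g [pg] ?; split=> //.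
    by apply: (theta_cap_interpolate aa bb cc dd).
  by apply: (theta_cap_interpolate cc dd aa bb); rewrite // joinC.
have isov := diamond_iso p_id v_id vC; have isow := diamond_iso p_id w_id wC.
have closed := factor_join_closed p_id v_id vC.
move: isov isow closed; rewrite meet // (joinC a c) meet // -(joinC a c) joinE.
move=> isov isow closed; apply: semigroup_iso_trans isow.
exact: semigroup_iso_sym.
Qed.

End DualIsomorphism.

(** * Steps of series and insertion of terms *)

Section Series.
Variable S : monoidType.
Implicit Types (C : S -> S -> Prop) (z x : S).

Lemma src_inord (T : Type) n (e : 'I_n.+1 -> T) (i : 'I_n) : src e i = e (inord i).
Proof. by rewrite /src; congr e; apply: val_inj; rewrite /= inordK // ltnS ltnW. Qed.

Lemma tgt_inord (T : Type) n (e : 'I_n.+1 -> T) (i : 'I_n) : tgt e i = e (inord i.+1).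
Proof. by rewrite /tgt; congr e; apply: val_inj; rewrite /= inordK // ltnS. Qed.

Lemma src_neq_tgt (T : Type) n (e : 'I_n.+1 -> T) (i : 'I_n) :
  injective e -> src e i <> tgt e i.
Proof.
move=> e_inj /e_inj /(congr1 val) /= /eqP.
by rewrite /bump leq0n add1n ltn_eqF.
Qed.

(** The jump ends at the least index with value [b], which is positive because [a <> b]. Before it
    the value is always [a], from it on always [b]. *)
Lemma unique_jump (T : Type) m (g : 'I_m.+1 -> T) (a b : T) :
  g ord0 = a -> g ord_max = b -> a <> b ->
  (forall j, src g j = a -> tgt g j = a \/ tgt g j = b) ->
  (forall j, src g j = b -> tgt g j = b) ->
  exists j, [/\ src g j = a, tgt g j = b & forall j', src g j' <> tgt g j' -> j' = j].
Proof.
move=> g0 gm ab stepa stepb; pose G k := g (inord k).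
have G0 : G 0 = a by rewrite -g0; congr g; apply: val_inj; rewrite /= inordK.
have Gm : G m = b by rewrite -gm; congr g; apply: val_inj; rewrite /= inordK.
have Ga k : k < m -> G k = a -> G k.+1 = a \/ G k.+1 = b.
  by move=> km; have := stepa (Ordinal km); rewrite src_inord tgt_inord.
have Gb k : k < m -> G k = b -> G k.+1 = b.
  by move=> km; have := stepb (Ordinal km); rewrite src_inord tgt_inord.
have Gab k : k <= m -> G k = a \/ G k = b.
  elim: k => [|k IHk] km; first by left.
  by case: (IHk (ltnW km)) => [/(Ga _ km) //|/(Gb _ km)]; right.
have Gstay k l : k <= l -> l <= m -> G k = b -> G l = b.
  elim: l => [|l IHl]; first by rewrite leqn0 => /eqP ->.
  rewrite leq_eqVlt ltnS => /orP [/eqP -> //|kl] lm /(IHl kl (ltnW lm)).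
  exact: Gb.
have exb : exists k, `[< G k = b >] by exists m; apply/asboolP.
case: (ex_minnP exb) => -[|k] /asboolP Gk kmin; first by rewrite G0 in Gk.
have before l : l <= k -> G l <> b.
  by move=> lk /asboolP /kmin; rewrite leqNgt ltnS lk.
have km : k < m by apply: kmin; apply/asboolP.
have isa l : l <= k -> G l = a.
  by move=> lk; case: (Gab l (leq_trans lk (ltnW km))) => // /(before _ lk).
exists (Ordinal km); rewrite src_inord tgt_inord; split=> //=; first exact: isa.
move=> j; rewrite src_inord tgt_inord -!/(G _) => jumpj; apply: val_inj => /=.
have [jk|kj|//] := ltngtP j k.
  by case: jumpj; rewrite !isa // ltnW.
have Gj := Gstay _ _ kj (ltnW (ltn_ord j)) Gk.
by case: jumpj; rewrite Gj Gb.
Qed.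

(** [factor x x] has the single element [x], whereas [factor c d] contains both [c] and [d]. *)
Lemma factor_refl_iso (c d : S) x : x * x = x -> c * c = c -> d * d = d -> c * d = c ->
  inverse_monoid S -> semigroup_iso (factor x x) (factor c d) -> c = d.
Proof.
move=> xx cc dd cd S_inverse [phi [[_ _ phi_surj] _]].
have only t : factor x x t -> t = x by move=> [s /(natural_leE S_inverse _ xx) ? <-].
have [y /only -> <-] : (phi @` factor x x) c.
  apply: phi_surj; exists c; first by apply/natural_leE.
  by rewrite (idempotentC S_inverse dd cc).
have [t /only -> <- //] : (phi @` factor x x) d.
by apply: phi_surj; exists d => //; apply/natural_leE.
Qed.

Definition insert_term n (e : 'I_n.+1 -> S) (i : 'I_n) x (k : 'I_n.+2) : S :=
  if k <= i then e (inord k) else if k == i.+1 :> nat then x else e (inord k.-1).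

Lemma insert_term_step n (e : 'I_n.+1 -> S) (i : 'I_n) x (P : S -> S -> Prop) :
  (forall k, P (src e k) (tgt e k)) -> P (src e i) x -> P x (tgt e i) ->
  forall k, P (src (insert_term e i x) k) (tgt (insert_term e i x) k).
Proof.
move=> Pe Pix Pxi k.
have step l : l < n -> P (e (inord l)) (e (inord l.+1)).
  by move=> ln; have := Pe (Ordinal ln); rewrite src_inord tgt_inord.
rewrite /src /tgt /insert_term /= /bump /= add1n eqSS.
move: Pix Pxi; rewrite src_inord tgt_inord => Pix Pxi.
have [ki|ik|ki] := ltngtP k i.
- by apply: step; apply: ltn_trans ki _.
- have [->|ki1] := eqVneq (k : nat) i.+1; first by [].
  have k0 : 0 < k by apply: leq_trans ik.
  by rewrite -{2}(prednK k0); apply: step; rewrite prednK // -ltnS.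
- by rewrite ki.
Qed.

Hypothesis S_inverse : inverse_monoid S.

Lemma series_monotone C z n (e : 'I_n.+1 -> S) (k l : nat) :
  idempotent_series C z e -> k <= l -> l <= n ->
  e (inord k) * e (inord l) = e (inord k).
Proof.
move=> [_ _ eid ele _]; elim: l => [|l IHl].
  by rewrite leqn0 => /eqP -> _; apply: eid.
rewrite leq_eqVlt ltnS => /orP [/eqP -> _|kl ln]; first exact: eid.
apply: natural_le_trans (IHl kl (ltnW ln)) _.
have /natural_leE := ele (Ordinal ln); rewrite src_inord tgt_inord.
by apply; last exact: eid.
Qed.

(** Inserting [x] after position [i] gives a refinement, so by maximality [x] is already a term. *)
Lemma composition_series_gap C z n (e : 'I_n.+1 -> S) (i : 'I_n) x :
  composition_series C z e -> x * x = x ->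
  src e i * x = src e i -> x * tgt e i = x ->
  C (src e i) x -> C x (tgt e i) -> x = src e i \/ x = tgt e i.
Proof.
move=> [e_series _ emax] xx ix xi Cix Cxi.
have [e0 e1 eid ele eC] := e_series.
have /(emax n.+1) sub : idempotent_series C z (insert_term e i x).
  split.
  - by rewrite -e0 /insert_term; congr e; apply: val_inj; rewrite /= inordK.
  - rewrite -e1 /insert_term /= leqNgt ltnS ltnW ?ltn_ord //= eqSS.
    rewrite gtn_eqF ?ltn_ord //; congr e; apply: val_inj; rewrite /= inordK //.
  - by move=> k; rewrite /insert_term; case: ifP => // _; case: ifP.
  - apply: insert_term_step => //; apply/natural_leE => //; exact: eid.
  - exact: insert_term_step.
have [k _ xE] : range e x.
  apply: sub; last first.
    exists (inord i.+1) => //.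
    by rewrite /insert_term inordK ?ltnS ?(ltnW (ltn_ord i)) // ltnn eqxx.
  move=> _ [k _ <-]; have [ki|ik] := leqP k i.
    exists (inord k) => //; rewrite /insert_term inordK ?ki ?inord_val //.
    by rewrite ltnS ltnW.
  exists (inord k.+1) => //; rewrite /insert_term inordK ?ltnS ?ltn_ord //.
    by rewrite leqNgt ltnS ltnW //= eqSS gtn_eqF // inord_val.
  by rewrite -ltnS.
have antisym (a b : S) : a * a = a -> b * b = b -> a * b = a -> b * a = b -> a = b.
  by move=> aa bb ab ba; rewrite -[LHS]ab -[RHS]ba; apply: idempotentC.
move: ix xi; rewrite src_inord tgt_inord -xE => ix xi.
(* A term at index [k <= i] lies below [src e i], a later one above [tgt e i]; together with the
   position of [x] between the two, this forces equality. *)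
have [ki|ik] := leqP k i; [left | right].
  apply: antisym => //; try exact: eid.
  by have := series_monotone e_series ki (ltnW (ltn_ord i)); rewrite inord_val.
have kn : k <= n by rewrite -ltnS.
apply: antisym => //; try exact: eid.
by have := series_monotone e_series ik kn; rewrite inord_val.
Qed.

(** * The Jordan-Hölder argument for both kinds of series *)

Hypothesis S_factorizable : factorizable S.
Hypothesis theta_dual_iso : natural_connection_dual_iso S.
(** [C] stands for either centrality condition. [C_interval] lets an inserted term keep its relation
    to the term above it, and [C_up] feeds the butterfly. *)
Variables (C : S -> S -> Prop) (z : S).
Hypothesis z_zero : is_zero z.
Hypothesis C_interval : forall a x b, a * a = a -> x * x = x -> a * x = a -> x * b = x ->
  C a b -> C x b.
Hypothesis C_up : forall a b, a * a = a -> b * b = b -> a * b = a -> C a b ->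
  central_in (up_set a) b.

(* Along the interpolation of [f] between two consecutive terms of [e], the
   first term different from [src e i] is already [tgt e i], as otherwise it
   could be inserted in [e]. *)
Lemma interpolation_jump n m (e : 'I_n.+1 -> S) (f : 'I_m.+1 -> S) (i : 'I_n) :
  composition_series C z e -> idempotent_series C z f ->
  (forall j, C (interpolate (src e i) (tgt e i) (src f j))
               (interpolate (src e i) (tgt e i) (tgt f j))) ->
  exists j, [/\ interpolate (src e i) (tgt e i) (src f j) = src e i,
                interpolate (src e i) (tgt e i) (tgt f j) = tgt e i &
                forall j', interpolate (src e i) (tgt e i) (src f j') <>
                           interpolate (src e i) (tgt e i) (tgt f j') -> j' = j].
Proof.
move=> e_comp [f0 f1 fid fle _] intC.
have [[e0 e1 eid ele eC] e_inj _] := e_comp.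
have [aa bb] : src e i * src e i = src e i /\ tgt e i * tgt e i = tgt e i.
  by split; apply: eid.
have ab : src e i * tgt e i = src e i by apply/natural_leE.
have [z_id zl] : z * z = z /\ forall s, z * s = z.
  by split=> [|s]; case: (z_zero z) => // _ _; case: (z_zero s).
have fleE j : src f j * tgt f j = src f j.
  by apply/natural_leE => //; apply: fid.
pose g j := interpolate (src e i) (tgt e i) (f j).
have gid j : g j * g j = g j by apply: interpolate_idempotent => //; apply: fid.
have gmono j : src g j * tgt g j = src g j.
  by apply: interpolate_monotone => //; first [exact: fid | exact: fleE].
apply: (@unique_jump _ _ g).
- by rewrite /g f0 interpolate_bot.
- by rewrite /g f1 interpolate_top ?mulg1.
- exact: src_neq_tgt.
- move=> j gj; have gtb : tgt g j * tgt e i = tgt g j.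
    by apply: interpolate_le => //; apply: fid.
  have agt : src e i * tgt g j = src e i.
    by apply: interpolate_ge => //; apply: fid.
  have gg : tgt g j * tgt g j = tgt g j by apply: gid.
  apply: (composition_series_gap e_comp) => //; last exact: C_interval (eC i).
  by rewrite -{1}gj; apply: intC.
- move=> j gj; have := gmono j; rewrite gj => <-.
  rewrite (idempotentC S_inverse bb); last exact: gid.
  by apply/esym/interpolate_le => //; apply: fid.
Qed.

Lemma composition_series_isomorphic n m (e : 'I_n.+1 -> S) (f : 'I_m.+1 -> S) :
  composition_series C z e -> composition_series C z f ->
  (forall i j, C (interpolate (src e i) (tgt e i) (src f j))
                 (interpolate (src e i) (tgt e i) (tgt f j))) ->
  (forall j i, C (interpolate (src f j) (tgt f j) (src e i))
                 (interpolate (src f j) (tgt f j) (tgt e i))) ->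
  isomorphic_series e f.
Proof.
move=> e_comp f_comp Cef Cfe.
have [[e_ser _ _] [f_ser _ _]] := (e_comp, f_comp).
have [_ _ eid ele eC] := e_ser; have [_ _ fid fle fC] := f_ser.
have eleE i : src e i * tgt e i = src e i by apply/natural_leE => //; apply: eid.
have fleE j : src f j * tgt f j = src f j by apply/natural_leE => //; apply: fid.
have eC_up i : central_in (up_set (src e i)) (tgt e i).
  by apply: C_up => //; apply: eid.
have fC_up j : central_in (up_set (src f j)) (tgt f j).
  by apply: C_up => //; apply: fid.
have eZ i c d : c * c = c -> d * d = d -> central_in (up_set c) d ->
    semigroup_iso (factor (interpolate (src e i) (tgt e i) c)
                          (interpolate (src e i) (tgt e i) d))
                  (factor (interpolate c d (src e i)) (interpolate c d (tgt e i))).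
  by move=> cc dd dC; apply: zassenhaus_iso => //; apply: eid.
have fZ j c d : c * c = c -> d * d = d -> central_in (up_set c) d ->
    semigroup_iso (factor (interpolate (src f j) (tgt f j) c)
                          (interpolate (src f j) (tgt f j) d))
                  (factor (interpolate c d (src f j)) (interpolate c d (tgt f j))).
  by move=> cc dd dC; apply: zassenhaus_iso => //; apply: fid.
have iso i j := eZ i _ _ (fid _) (fid _) (fC_up j).
have iso' i j := fZ j _ _ (eid _) (eid _) (eC_up i).
have [sigma sigmaP] := choice (fun i => interpolation_jump e_comp f_ser (Cef i)).
have [tau tauP] := choice (fun j => interpolation_jump f_comp e_ser (Cfe j)).
have e_neq i : src e i <> tgt e i by case: e_comp => _ /src_neq_tgt.
have f_neq j : src f j <> tgt f j by case: f_comp => _ /src_neq_tgt.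
(* Otherwise [e] interpolated at [sigma i] is constant across step [i], so its factor there is
   trivial. The butterfly makes it isomorphic to the factor of [e] at [i], whose ends are
   distinct. *)
have sigmaK i : tau (sigma i) = i.
  have [_ _ only] := tauP (sigma i); apply/esym/only => collapse.
  have [si ti _] := sigmaP i; apply: (e_neq i).
  have := iso' i (sigma i); rewrite -collapse si ti.
  apply: factor_refl_iso => //; try exact: eid.
  by apply: interpolate_idempotent => //; first [exact: fid | exact: eid].
have tauK j : sigma (tau j) = j.
  have [_ _ only] := sigmaP (tau j); apply/esym/only => collapse.
  have [sj tj _] := tauP j; apply: (f_neq j).
  have := iso (tau j) j; rewrite -collapse sj tj.
  apply: factor_refl_iso => //; try exact: fid.
  by apply: interpolate_idempotent => //; first [exact: eid | exact: fid].
have sigma_bij : bijective sigma by exists tau.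
split; first by have := bij_eq_card sigma_bij; rewrite !card_ord.
(* At matched positions both interpolations make their full jump, so the butterfly compares the
   original factors. *)
exists sigma; split=> // i; have := iso i (sigma i).
have [-> -> _] := sigmaP i.
by have [] := tauP (sigma i); rewrite sigmaK => -> ->.
Qed.

End Series.

(** * Specialization to subcentral and to central series *)

Theorem theorem2p8 (S : monoidType) (z : S)
    (S_inverse : inverse_monoid S) (z_zero : is_zero z)
    (S_factorizable : factorizable S)
    (theta_dual_iso : natural_connection_dual_iso S) :
  (forall (n m : nat) (e : 'I_n.+1 -> S) (f : 'I_m.+1 -> S),
     composition_subcentral_series z e -> composition_subcentral_series z f ->
     isomorphic_series e f) /\
  (forall (n m : nat) (e : 'I_n.+1 -> S) (f : 'I_m.+1 -> S),
     composition_central_series z e -> composition_central_series z f ->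
     isomorphic_series e f).
Proof.
split=> n m e f e_comp f_comp.
  have [[[_ _ eid _ eC] _ _] [[_ _ fid _ fC] _ _]] := (e_comp, f_comp).
  apply: (composition_series_isomorphic S_inverse S_factorizable theta_dual_iso
            z_zero _ _ e_comp f_comp) => //.
  - by move=> a x b aa xx ax xb; apply: central_in_up_sub.
  - move=> i j; apply: interpolate_central_up => //;
      first [exact: eid | exact: fid | exact: eC | exact: fC].
  - move=> j i; apply: interpolate_central_up => //;
      first [exact: eid | exact: fid | exact: eC | exact: fC].
(* Each term but the first is the upper end of a step, and the first is the zero, which is central
   as well. *)
have all_central k (h : 'I_k.+1 -> S) :
    idempotent_series (fun _ b => central_in [set: S] b) z h ->
    forall l, central_in [set: S] (h l).
  move=> [h0 _ _ _ hC] l; have [l' ->|->] := unliftP ord0 l; first exact: hC.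
  rewrite h0; split=> // t _; rewrite /commute.
  by have [-> ->] := z_zero t.
have [[e_ser _ _] [f_ser _ _]] := (e_comp, f_comp).
have [[_ _ eid _ _] [_ _ fid _ _]] := (e_ser, f_ser).
have [eC fC] := (all_central _ _ e_ser, all_central _ _ f_ser).
apply: (composition_series_isomorphic S_inverse S_factorizable theta_dual_iso
          z_zero _ _ e_comp f_comp) => //.
- by move=> a b aa bb ab; apply: central_in_setT_up.
- move=> i j; apply: interpolate_central => //;
    first [exact: eid | exact: fid | exact: eC | exact: fC].
- move=> i j; apply: interpolate_central => //;
    first [exact: eid | exact: fid | exact: eC | exact: fC].
Qed.
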